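(* Let $\mathbb D$ and $\mathbb E$ be real vector spaces equipped with semimetrics $d$ and $e$, respectively. Let $\mathbb D_\Psi\subset\mathbb D$ and let $\Psi:\mathbb D_\Psi\to\mathbb E$ be semi-Hadamard differentiable at $x\in\mathbb D_\Psi$ tangentially to $\mathbb W\subset\mathbb D$ with derivative $d\Psi_x$. Let $Y_n$, $n\ge1$, and $X$ be maps from probability spaces into $\mathbb D$ such that $Y_n$ takes values in $\mathbb D_\Psi$ and $X$ takes values in $\mathbb W$. Assume that $X$ is Borel measurable and that there exists a positive sequence $r_n$ tending to infinity such that, in $([\mathbb D],d)$, $$[r_n(Y_n-x)]\rightsquigarrow[X],\qquad n\to\infty.$$ Passing to a suitable version of $X$ if necessary to ensure measurability of $d\Psi_x(X)$, we then have, in $([\mathbb E],e)$, $$[r_n(\Psi(Y_n)-\Psi(x))]\rightsquigarrow[d\Psi_x(X)],\qquad n\to\infty.$$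
   Context: A semimetric satisfies all axioms of a metric except that $d(x,y)=0$ need not imply $x=y$. Addition on $\mathbb D$ and $\mathbb E$ is not required to be continuous, nor to be well defined on equivalence classes. For $x\in\mathbb D$, $[x]=\{y\in\mathbb D:d(x,y)=0\}$, and $[\mathbb D]$ is the metric space of such classes with $d([x],[y])=d(x,y)$; similarly $[\mathbb E]$ with $e$. $[X]$ is the composition of $X$ with $x\mapsto[x]$. Semi-Hadamard differentiability: $\Psi:\mathbb D_\Psi\to\mathbb E$ is semi-Hadamard differentiable at $x\in\mathbb D_\Psi$ tangentially to $\mathbb W\subset\mathbb D$ if there exists a map $d\Psi_x:\mathbb W\to\mathbb E$ (the derivative; not assumed linear or continuous) such that for every $w\in\mathbb W$, every sequence $t_n\in(0,\infty)$ with $t_n\to0$ and every sequence $w_n\in\mathbb D$ with $x+t_nw_n\in\mathbb D_\Psi$ for all $n$ and $w_n\to w$, we have $t_n^{-1}(\Psi(x+t_nw_n)-\Psi(x))\to d\Psi_x(w)$ as $n\to\infty$ (convergence with respect to $d$ and $e$). A version of $X$ is a Borel measurable $\mathbb W$-valued map, on the same probability space, almost surely equal to $X$; the conclusion asserts that either $d\Psi_x(X)$ is Borel measurable and the convergence holds, or there is a version $X'$ of $X$ with $d\Psi_x(X')$ Borel measurable and the convergence holds with $X'$ in place of $X$. Weak convergence is in the Hoffmann-Jørgensen sense: $Y_n\rightsquigarrow Y$ (with $Y$ Borel measurable) means $E^*[h(Y_n)]\to E[h(Y)]$ for every bounded continuous real function $h$, where $E^*$ is outer expectation; the maps $Y_n$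 need not be measurable. *)

(* Defs.v *)
From HB Require Import structures.
From mathcomp Require Import all_boot all_order all_algebra.
From mathcomp Require Import all_classical all_reals all_analysis.
From mathcomp Require Import measurable_realfun.
Set Implicit Arguments.
Unset Strict Implicit.
Unset Printing Implicit Defensive.
Import Order.TTheory GRing.Theory Num.Theory.
Import numFieldNormedType.Exports.

Local Open Scope classical_set_scope.
Local Open Scope ring_scope.

Record semimetric (R : realType) (D : Type) := Semimetric {
  sdist :> D -> D -> R ;
  sdist_ge0 : forall x y, 0 <= sdist x y ;
  sdistxx : forall x, sdist x x = 0 ;
  sdist_sym : forall x y, sdist x y = sdist y x ;
  sdist_triangle : forall x y z, sdist x z <= sdist x y + sdist y z }.

(* [D] seen as a (in general not separated) topological space through [d]. *)
Definition semimetric_space (R : realType) (D : lmodType R)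
  (d : semimetric R D) : Type := D.

Section semimetric_space.
Variables (R : realType) (D : lmodType R) (d : semimetric R D).
Local Notation S := (semimetric_space d).

Let sball (x : S) (r : R) : set S := [set y | d x y < r].

Let sball_center (x : S) (r : R) : 0 < r -> sball x r x.
Proof. by rewrite /sball /= sdistxx. Qed.

Let sball_sym (x y : S) (r : R) : sball x r y -> sball y r x.
Proof. by rewrite /sball /= sdist_sym. Qed.

Let sball_triangle (x y z : S) (r1 r2 : R) :
  sball x r1 y -> sball y r2 z -> sball x (r1 + r2) z.
Proof.
by move=> xy yz; rewrite /sball /= (le_lt_trans (sdist_triangle d x y z))// ltrD.
Qed.

HB.instance Definition _ := Choice.on S.
HB.instance Definition _ := isPointed.Build S (0 : D).
HB.instance Definition _ := hasNbhs.Build S (nbhs_ (entourage_ sball)).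
HB.instance Definition _ := @Nbhs_isPseudoMetric.Build R S
  (entourage_ sball) erefl sball sball_center sball_sym sball_triangle erefl.

Definition sdist0 : rel D := fun x y => d x y == 0.

Lemma sdist0_refl : reflexive sdist0.
Proof. by move=> x; rewrite /sdist0 sdistxx eqxx. Qed.

Lemma sdist0_sym : symmetric sdist0.
Proof. by move=> x y; rewrite /sdist0 sdist_sym. Qed.

Lemma sdist0_trans : transitive sdist0.
Proof.
move=> y x z /eqP xy /eqP yz; rewrite /sdist0 eq_le sdist_ge0 andbT.
by rewrite (le_trans (sdist_triangle d x y z))// xy yz addr0.
Qed.

Definition sdist0_equiv := EquivRel sdist0 sdist0_refl sdist0_sym sdist0_trans.

End semimetric_space.

(* The metric space of the classes [x] = {y | d x y = 0}. *)
Definition semimetric_quotient (R : realType) (D : lmodType R)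
  (d : semimetric R D) : Type := {eq_quot (sdist0_equiv d)}%qT.

Definition sclass (R : realType) (D : lmodType R) (d : semimetric R D) (x : D) :
  semimetric_quotient d := (\pi_({eq_quot (sdist0_equiv d)}%qT) x)%qT.

Section semimetric_quotient.
Variables (R : realType) (D : lmodType R) (d : semimetric R D).
Local Notation Q := (semimetric_quotient d).

HB.instance Definition _ := Choice.on Q.
HB.instance Definition _ := isPointed.Build Q (sclass d 0).

Lemma sclass_eq (x y : D) : sclass d x = sclass d y <-> d x y = 0.
Proof.
split=> [/eqmodP /eqP //|xy]; apply/eqmodP => /=.
by rewrite /sdist0 xy eqxx.
Qed.

Definition srepr (a : Q) : D := repr (a : {eq_quot (sdist0_equiv d)}%qT).

Lemma sreprK (a : Q) : sclass d (srepr a) = a.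
Proof. exact: reprK. Qed.

Let qdist (a b : Q) : R := d (srepr a) (srepr b).

Let qdistxx (a : Q) : qdist a a = 0.
Proof. exact: sdistxx. Qed.

Let qdist_positivity (a b : Q) : qdist a b = 0 -> a = b.
Proof. by move/sclass_eq; rewrite !sreprK. Qed.

Let qdist_sym (a b : Q) : qdist a b = qdist b a.
Proof. exact: sdist_sym. Qed.

Let qdist_triangle (b a c : Q) : qdist a c <= qdist a b + qdist b c.
Proof. exact: sdist_triangle. Qed.

HB.instance Definition _ := @isMetric.Build R Q
  qdist qdistxx qdist_positivity qdist_sym qdist_triangle.

Lemma mdist_sclass (x y : D) : mdist (sclass d x) (sclass d y) = d x y.
Proof.
have d0 z : d z (srepr (sclass d z)) = 0.
  by apply/sclass_eq; rewrite sreprK.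
have d0' z : d (srepr (sclass d z)) z = 0 by rewrite sdist_sym.
apply/eqP; rewrite eq_le; apply/andP; split.
- rewrite -[leRHS]addr0 -(d0 y) (le_trans (sdist_triangle d _ x _))//.
  by rewrite d0' add0r sdist_triangle.
- rewrite (le_trans (sdist_triangle d _ (srepr (sclass d x)) _))// d0 add0r.
  rewrite (le_trans (sdist_triangle d _ (srepr (sclass d y)) _))//.
  by rewrite d0' addr0.
Qed.

End semimetric_quotient.

Definition borel_measurable (d0 : measure_display) (T : measurableType d0)
    (S : ptopologicalType) (X : T -> S) : Prop :=
  measurable_fun [set: T] (X : T -> g_sigma_algebraType (@open S)).

(* The expectation of a measurable [U] exists in the extended reals as soon as
   its positive or its negative part has finite integral. *)
Definition outer_expectation (R : realType) (d0 : measure_display)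
    (T : measurableType d0) (P : probability T R) (Z : T -> R) : \bar R :=
  ereal_inf [set (\int[P]_t U t)%E | U in [set U : T -> \bar R |
    [/\ measurable_fun [set: T] U,
        (\int[P]_t (U^\+)%E t < +oo)%E \/ (\int[P]_t (U^\-)%E t < +oo)%E
      & forall t, ((Z t)%:E <= U t)%E]]].

(* Hoffmann-Joergensen weak convergence: each map lives on its own probability
   space and only the limit is required to be measurable. *)
Definition weak_cvg (R : realType) (S : ptopologicalType)
    (dO : nat -> measure_display) (Om : forall n, measurableType (dO n))
    (P : forall n, probability (Om n) R) (Y_ : forall n, Om n -> S)
    (dT : measure_display) (T : measurableType dT) (Q : probability T R)
    (Y : T -> S) : Prop :=
  borel_measurable Y /\
  forall h : S -> R, continuous h -> bounded_fun h ->
    (fun n => outer_expectation (P n) (h \o Y_ n)) @ \oo --> ('E_Q[h \o Y])%E.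

(* [Psi] and [dPsi] are total functions of which only the restrictions to
   [DPsi] and [W] matter. *)
Definition is_semi_hadamard (R : realType) (D E : lmodType R)
    (d : semimetric R D) (e : semimetric R E) (DPsi : set D) (Psi : D -> E)
    (x : D) (W : set D) (dPsi : D -> E) : Prop :=
  forall w : D, W w ->
  forall (t : nat -> R) (w_ : nat -> D),
    (forall n, 0 < t n) -> t @ \oo --> (0 : R) ->
    (forall n, DPsi (x + t n *: w_ n)) ->
    (fun n => d (w_ n) w) @ \oo --> (0 : R) ->
    (fun n => e ((t n)^-1 *: (Psi (x + t n *: w_ n) - Psi x)) (dPsi w))
      @ \oo --> (0 : R).

Definition is_version (R : realType) (D : lmodType R) (d : semimetric R D)
    (W : set D) (dT : measure_display) (T : measurableType dT)
    (Q : probability T R) (X X' : T -> D) : Prop :=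
  [/\ borel_measurable (X' : T -> semimetric_space d),
      forall t, W (X' t)
    & {ae Q, forall t, X' t = X t}].

(* Main.v *)
(* The theorem is an extended continuous mapping theorem for the maps
   [G m v = r m *: (Psi (x + (r m)^-1 *: v) - Psi x)] on
   [A m = [set v | DPsi (x + (r m)^-1 *: v)]]: semi-Hadamard differentiability
   says that [G m v] is close to [dPsi w] as soon as [m] is large and [v \in A m]
   is close to [w].

   No separability is available, so almost sure representations are avoided.
   For [h] bounded and continuous, let [env k] be the least [k.+1]-Lipschitz
   function above all [h \o G m] on [A m], [m >= k]. Since [Z n], the rescaled
   [Y n], lies in [A n], [E^*(h(G n (Z n))) <= E^*(env k (Z n))] for [n >= k],
   which tends to [E(env k X)]; and [limsup_k env k w <= h (dPsi w)] for [w]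
   in [W]. Dominated convergence gives the upper half of the convergence, and
   [- h] gives the lower half.

   The envelopes of [h = 0] (with floor [- 1]) have expectation 0 at [X], so [X]
   is almost surely a limit of points of the sets [A m]. On the limit points in
   [W], [dPsi] is continuous; elsewhere it is arbitrary, whence the version of
   [X], redefined on a null set to be a limit point everywhere. *)
Require Import Defs.
From HB Require Import structures.
From mathcomp Require Import all_boot all_order all_algebra.
From mathcomp Require Import all_classical all_reals all_analysis.
From mathcomp Require Import measurable_realfun.
From mathcomp Require Import lra.
Set Implicit Arguments.
Unset Strict Implicit.
Unset Printing Implicit Defensive.
Import Order.TTheory GRing.Theory Num.Theory.
Import numFieldNormedType.Exports.

Local Open Scope classical_set_scope.
Local Open Scope ring_scope.

(** * Order and sign properties of the outer expectation *)

Section outer_expectation.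
Variables (R : realType) (d0 : measure_display) (T : measurableType d0).
Variable P : probability T R.
Implicit Types Z : T -> R.

Lemma le_outer_expectation Z1 Z2 : (forall t, Z1 t <= Z2 t) ->
  (outer_expectation P Z1 <= outer_expectation P Z2)%E.
Proof.
move=> Z12; apply: ereal_inf_le_tmp => _ [U [mU iU ZU] <-].
by exists U => //; split => // t; rewrite (le_trans _ (ZU t))// lee_fin.
Qed.

(** If [U] majorizes [Z] and [V] majorizes [- Z], then [- V <= Z <= U] pointwise, and the integrals
    are compared through positive and negative parts. This turns an upper bound for [- h] into a
    lower bound for [h]. *)
Lemma oppe_outer_expectation Z :
  (- outer_expectation P (fun t => - Z t)%R <= outer_expectation P Z)%E.
Proof.
apply/ereal_infP => _ [U [mU _ ZU] <-]; rewrite leeNl.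
apply/ereal_infP => _ [V [mV iV ZV] <-]; rewrite leeNl.
have VU t : (- V t <= U t)%E.
  by apply: le_trans (ZU t); rewrite leeNl; exact: ZV.
have VUp : (\int[P]_t V^\- t <= \int[P]_t U^\+ t)%E.
  apply: ge0_le_integral => //.
  - exact: measurable_funeneg.
  - exact: measurable_funepos.
  - move=> t _; rewrite -funeposN.
    by apply: (@funepos_le _ _ setT); rewrite ?inE// => s _.
have UVp : (\int[P]_t U^\- t <= \int[P]_t V^\+ t)%E.
  apply: ge0_le_integral => //.
  - exact: measurable_funeneg.
  - exact: measurable_funepos.
  - move=> t _; rewrite -funenegN.
    by apply: (@funeneg_le _ _ setT); rewrite ?inE// => s _.
(* By [iV] the integrals of [V^\+] and [V^\-] are not both infinite, so the opposite distributes
   over their difference. *)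
rewrite integralE [leRHS]integralE oppeB; last first.
  have Vp0 : (0 <= \int[P]_t V^\+ t)%E by exact: integral_ge0.
  have Vn0 : (0 <= \int[P]_t V^\- t)%E by exact: integral_ge0.
  by case: iV Vp0 Vn0; do 2 case: (integral _ _ _).
by rewrite [leLHS]addeC; exact: leeB.
Qed.

Lemma outer_expectation_ge0 Z : (forall t, 0 <= Z t) ->
  (0 <= outer_expectation P Z)%E.
Proof.
move=> Z0; apply/ereal_infP => _ [U [_ _ ZU] <-].
by apply: integral_ge0 => t _; apply: le_trans (ZU t); rewrite lee_fin.
Qed.

End outer_expectation.

(** * Criteria for measurability, boundedness, convergence and continuity *)

Section borel_measurable.
Variables (R : realType) (d0 : measure_display) (T : measurableType d0).
Variable S : ptopologicalType.

Lemma borel_measurableP (X : T -> S) :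
  borel_measurable X <-> forall U, open U -> measurable (X @^-1` U).
Proof.
split=> [mX U oU|mX].
  rewrite -[X @^-1` U]setTI; apply: mX => //; exact: sub_sigma_algebra.
apply: (@measurability _ _ _ (g_sigma_algebraType (@open S)) _ _ (@open S)) => //.
move=> _ [U oU <-].
by rewrite setTI; exact: mX.
Qed.

Lemma borel_measurable_continuous (X : T -> S) (h : S -> R) :
  borel_measurable X -> continuous h -> measurable_fun setT (h \o X).
Proof.
move=> /borel_measurableP mX /continuousP ch.
apply: (measurability _ (RGenOpens.measurableE R)) => _ [_ [a [b ->] <-]].
by rewrite setTI comp_preimage; apply: mX; apply: ch; exact: interval_open.
Qed.

End borel_measurable.

Section bounded_fun.
Variables (R : realType) (S : Type).

Lemma bounded_funP (h : S -> R) :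
  bounded_fun h <-> exists2 M, 0 < M & forall a, `|h a| <= M.
Proof.
split=> [[M [_ hM]]|[M M0 hM]].
  exists (`|M| + 1) => [|a]; first by rewrite ltr_wpDl.
  by apply: hM => //; rewrite ltr_pwDr// ler_norm.
exists M; split; first exact: num_real.
by move=> x Mx a _; exact: le_trans (hM a) (ltW Mx).
Qed.

End bounded_fun.

Lemma cvge_fin_dist_le (R : realType) (u : nat -> \bar R) (a : R) :
  (forall eps : R, 0 < eps ->
    \forall n \near \oo, ((a - eps)%:E <= u n <= (a + eps)%:E)%E) ->
  u @ \oo --> a%:E.
Proof.
move=> ua; apply/fine_cvgP; split.
  apply: filterS (ua 1 ltr01) => n /andP[au ua1].
  by rewrite fin_numE; apply/andP; split; apply/eqP => un;
     move: au ua1; rewrite un.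
apply/cvgrPdist_le => eps eps0; apply: filterS (ua eps eps0) => n /=.
case: (u n) => [r| |]; rewrite ?leye_eq ?leeNy_eq ?andbF//= !lee_fin ler_distl.
by move=> /andP[? ?]; lra.
Qed.

Lemma lipschitz_metric_continuous (R : realType) (S : metricType R)
    (f : S -> R) (L : R) : 0 < L ->
  (forall a b, f a <= f b + L * mdist a b) -> continuous f.
Proof.
move=> L0 fL a; apply/cvgrPdist_le => eps eps0.
apply/nbhs_ballP; exists (eps / L) => /=; first exact: divr_gt0.
move=> b; rewrite ballEmdist /= ltr_pdivlMr// mulrC => ab.
have := fL a b; have := fL b a; rewrite metric_sym => fba fab.
by rewrite ler_distl; apply/andP; split; lra.
Qed.

(** * Lipschitz envelopes of tails of a sequence of functions *)

Section lipschitz_envelope.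
Variables (R : realType) (S : metricType R) (I : Type) (p : I -> S).
Variables (A : nat -> set I) (H : nat -> I -> R) (M : R).
Hypotheses (M0 : 0 <= M) (HM : forall m v, `|H m v| <= M).

Let values (k : nat) (a : S) : set R := [set - M] `|`
  [set y | exists m v, [/\ (k <= m)%N, A m v &
    y = H m v - k.+1%:R * mdist (p v) a]].

(* Sup-convolution of the tail [H m], [m >= k], with a cone of slope [k.+1]:
   the least [k.+1]-Lipschitz function above [- M] and all of these [H m]. *)
Definition lip_env (k : nat) (a : S) : R := sup (values k a).

Let values_neq0 k a : values k a !=set0.
Proof. by exists (- M); left. Qed.

Let values_ub k a : ubound (values k a) M.
Proof.
move=> _ [->|[m [v [_ _ ->]]]]; first by rewrite (le_trans _ M0)// oppr_le0.
rewrite lerBlDr (le_trans (ler_norm _))// (le_trans (HM m v))// lerDl.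
by rewrite mulr_ge0// mdist_ge0.
Qed.

Lemma lip_env_le k a b : - M <= b ->
  (forall m v, (k <= m)%N -> A m v ->
    H m v - k.+1%:R * mdist (p v) a <= b) ->
  lip_env k a <= b.
Proof.
move=> Mb Hb; apply: ge_sup => // _ [->//|[m [v [km Av ->]]]].
exact: Hb.
Qed.

Lemma lip_env_ge k a m v : (k <= m)%N -> A m v ->
  H m v - k.+1%:R * mdist (p v) a <= lip_env k a.
Proof.
move=> km Av; apply: ub_le_sup; first by exists M; exact: values_ub.
by right; exists m, v.
Qed.

Lemma lip_env_geN k a : - M <= lip_env k a.
Proof. by apply: ub_le_sup; [exists M; exact: values_ub|left]. Qed.

Lemma lip_env_norm_le k a : `|lip_env k a| <= M.
Proof. by rewrite ler_norml lip_env_geN/=; apply: ge_sup. Qed.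

Lemma le_lip_env k m v : (k <= m)%N -> A m v -> H m v <= lip_env k (p v).
Proof.
by move=> km /(lip_env_ge (p v) km); rewrite mdistxx mulr0 subr0.
Qed.

(** Each cone is [k.+1]-Lipschitz by the triangle inequality, and a supremum of such functions keeps
    the constant. *)
Lemma lip_env_continuous k : continuous (lip_env k).
Proof.
apply: (@lipschitz_metric_continuous _ _ _ k.+1%:R) => // a b.
apply: lip_env_le => [|m v km Av].
  by rewrite (le_trans (lip_env_geN k b))// lerDl mulr_ge0// mdist_ge0.
rewrite -lerBlDr (le_trans _ (lip_env_ge b km Av))// -addrA lerD2l -opprD.
by rewrite lerN2 -mulrDr ler_pM2l// metric_triangle.
Qed.

End lipschitz_envelope.

(** * Expectations of uniformly bounded functions *)

Lemma bounded_integrable (R : realType) (dT : measure_display)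
    (T : measurableType dT) (Q : probability T R) (f : T -> R) (M : R) :
  measurable_fun setT f -> (forall t, `|f t| <= M) ->
  Q.-integrable setT (EFin \o f).
Proof.
move=> mf fM; apply: (@le_integrable _ _ _ Q _ measurableT _ (EFin \o cst M)) => //.
- exact/measurable_EFinP.
- by move=> t _; rewrite lee_fin (le_trans (fM t))// ler_norm.
- exact: finite_measure_integrable_cst.
Qed.

(* Reverse Fatou lemma, through dominated convergence of the positive parts
   of [f_ k - f]. *)
Lemma expectation_limsup_le (R : realType) (dT : measure_display)
    (T : measurableType dT) (Q : probability T R) (f_ : nat -> T -> R)
    (f : T -> R) (M : R) :
  (forall k, measurable_fun setT (f_ k)) -> measurable_fun setT f ->
  (forall k t, `|f_ k t| <= M) -> (forall t, `|f t| <= M) ->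
  (forall t eps, 0 < eps -> \forall k \near \oo, f_ k t <= f t + eps) ->
  forall eps, 0 < eps ->
    \forall k \near \oo, ('E_Q[f_ k] <= 'E_Q[f] + eps%:E)%E.
Proof.
move=> mf_ mf f_M fM f_f eps eps0; rewrite unlock.
pose u k t := Num.max (f_ k t - f t) 0.
have mu k : measurable_fun setT (u k).
  by apply: measurable_maxr => //; exact: measurable_funB.
have uM k t : `|u k t| <= M + M.
  rewrite ger0_norm; last by rewrite le_max lexx orbT.
  have := f_M k t; have := fM t; rewrite !ler_norml => /andP[? ?] /andP[? ?].
  by rewrite ge_max; apply/andP; split; lra.
have u0 t : (fun k => (u k t)%:E) @ \oo --> 0%E.
  apply: cvge_fin_dist_le => e e0; apply: filterS (f_f t e e0) => k fke.
  rewrite !lee_fin /u le_max ge_max; apply/andP; split.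
    by apply/orP; right; lra.
  by apply/andP; split; lra.
have [_ _ /= +] := @dominated_convergence _ _ _ Q _ measurableT
  (fun k => EFin \o u k) (cst 0%E) (EFin \o cst (M + M))
  (fun k => (measurable_EFinP _ _).2 (mu k)) (measurable_cst _)
  (aeW _ (fun t _ => u0 t))
  (finite_measure_integrable_cst _ _ measurableT)
  (aeW _ (fun t k _ => uM k t)).
rewrite integral0 => /fine_cvgP[ufin /cvgrPdist_le/(_ _ eps0)].
apply: filterS2 ufin => k uk.
rewrite sub0r normrN => ueps.
have if_ : Q.-integrable setT (EFin \o f_ k) by exact: bounded_integrable.
have if0 : Q.-integrable setT (EFin \o f) by exact: bounded_integrable.
rewrite -leeBlDl; last exact: integrable_fin_num.
rewrite -integralB_EFin//; apply: (@le_trans _ _ (\int[Q]_t (u k t)%:E)%E).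
  apply: le_integral => //.
  - under eq_fun do rewrite -EFinB.
    apply: (@bounded_integrable _ _ _ _ (fun t => f_ k t - f t) (M + M)).
      exact: measurable_funB.
    by move=> t; rewrite (le_trans (ler_normB _ _))// lerD.
  - exact: bounded_integrable (mu k) (uM k).
  - by move=> t _; rewrite -EFinB lee_fin le_max lexx.
by rewrite -(fineK uk) lee_fin; exact: le_trans (ler_norm _) ueps.
Qed.

(** * Semimetric neighbourhoods and the passage to classes *)

Lemma near_semimetricP (R : realType) (D : lmodType R) (d : semimetric R D)
    (w : semimetric_space d) (U : semimetric_space d -> Prop) :
  (\forall v \near w, U v) <-> exists2 delta, 0 < delta &
    forall v, d w v < delta -> U v.
Proof.
apply: iff_trans (@nbhs_ballP _ (semimetric_space d) w U) _.
by split=> -[r r0 rU]; exists r.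
Qed.

Lemma sclass_continuous (R : realType) (D : lmodType R) (d : semimetric R D) :
  continuous (sclass d : semimetric_space d -> semimetric_quotient d).
Proof.
move=> w U /nbhs_ballP[r r0 rU]; apply/near_semimetricP; exists r => // v wv.
by apply: rU; rewrite ballEmdist /= mdist_sclass.
Qed.

Lemma borel_measurable_sclass (R : realType) (D : lmodType R)
    (d : semimetric R D) (dT : measure_display) (T : measurableType dT)
    (X : T -> D) :
  borel_measurable (X : T -> semimetric_space d) ->
  borel_measurable (fun t => sclass d (X t)).
Proof.
move=> /borel_measurableP mX; apply/borel_measurableP => U oU.
by apply: (mX (sclass d @^-1` U));
  move/continuousP : (@sclass_continuous _ _ d); exact.
Qed.

(** * Limit points and envelopes for the extended continuous mapping theorem *)

Section extended_continuous_mapping.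
Variables (R : realType) (D E : lmodType R).
Variables (d : semimetric R D) (e : semimetric R E).
Variables (A : nat -> set D) (G : nat -> D -> E) (W : set D) (g : D -> E).

Hypothesis G_g : forall w, W w -> forall eps, 0 < eps ->
  exists2 delta, 0 < delta & exists N, forall m v,
    (N <= m)%N -> A m v -> d v w < delta -> e (G m v) (g w) < eps.

(* Points of [W] at which the maps [G m] determine [g] up to [e]-distance 0. *)
Let limit_pts : set D := [set w | W w /\
  forall N delta, 0 < delta -> exists m v, [/\ (N <= m)%N, A m v & d v w < delta]].

(** A single [G m v], with [m] large and [v] close to both [w] and [w'], is close to both [g w] and
    [g w']. *)
Let continuous_limit_pts w : limit_pts w -> forall eps, 0 < eps ->
  exists2 delta, 0 < delta & forall w', limit_pts w' -> d w w' < delta ->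
    e (g w) (g w') < eps.
Proof.
move=> [Ww _] eps eps0.
have eps20 : 0 < eps / 2 by rewrite divr_gt0.
have [delta delta0 [N hN]] := G_g Ww eps20.
exists (delta / 2) => [|w' [Ww' Lw'] ww']; first by rewrite divr_gt0.
have [delta' delta'0 [N' hN']] := G_g Ww' eps20.
(* The bound [delta'] serves [G_g] at [w']; the bound [delta / 2] keeps [v] within [delta] of
   [w]. *)
have min0 : 0 < Num.min delta' (delta / 2).
  by rewrite lt_min delta'0 divr_gt0.
have [m [v [+ Amv]]] := Lw' (maxn N N') _ min0.
rewrite geq_max lt_min => /andP[Nm N'm] /andP[vw' vw'2].
have vw : d v w < delta.
  rewrite (le_lt_trans (sdist_triangle d _ w' _))// [ltRHS]splitr ltrD//.
  by rewrite sdist_sym.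
rewrite (le_lt_trans (sdist_triangle e _ (G m v) _))// [ltRHS]splitr ltrD//.
  by rewrite sdist_sym; exact: hN.
exact: hN'.
Qed.

Let borel_comp_limit_pts (dT : measure_display) (T : measurableType dT)
    (X : T -> D) :
  borel_measurable (X : T -> semimetric_space d) ->
  (forall t, limit_pts (X t)) ->
  borel_measurable ((g \o X) : T -> semimetric_space e).
Proof.
move=> /borel_measurableP mX LX; apply/borel_measurableP => U oU.
(* The set [limit_pts] need not be Borel and [g] is controlled on it alone, so [V] admits every
   other point; its interior is open and has the right preimage because [X] stays in [limit_pts]. *)
pose V : set (semimetric_space d) :=
  [set w | limit_pts w -> U (g w : semimetric_space e)].
suff -> : (g \o X) @^-1` U = X @^-1` (interior V).
  by apply: mX; exact: open_interior.
apply/seteqP; split=> t /=; last by move=> /interior_subset; apply.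
move=> Ut; apply/near_semimetricP.
have /near_semimetricP[eps eps0 epsU] : nbhs (g (X t) : semimetric_space e) U.
  exact: open_nbhs_nbhs.
have [delta delta0 hdelta] := continuous_limit_pts (LX t) eps0.
by exists delta => // v Xv Lv; apply: epsU; exact: hdelta.
Qed.

(* Vanishes exactly at the points of the closure of the union of the
   [A m], [m >= k]. *)
Let slack k := lip_env (sclass d) A (fun _ _ => 0 : R) 1 k.

Let slack_le0 k a : slack k a <= 0.
Proof.
apply: lip_env_le => [|m v _ _]; first by rewrite oppr_le0.
by rewrite sub0r oppr_le0 mulr_ge0// mdist_ge0.
Qed.

Let slack0_limit_pts w : W w -> (forall k, slack k (sclass d w) = 0) ->
  limit_pts w.
Proof.
move=> Ww w0; split=> // N delta delta0; apply: contrapT => noapprox.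
have min0 : 0 < Num.min 1 delta by rewrite lt_min ltr01.
(* With no point of [A m], [m >= N], within [delta] of [w], every cone is at most [- delta] at [w],
   as its slope [N.+1] is at least 1; the 1 comes from the floor [- 1]. *)
suff : slack N (sclass d w) <= - Num.min 1 delta by rewrite w0 leNgt oppr_lt0 min0.
apply: lip_env_le => [|m v Nm Amv]; first by rewrite lerN2 ge_min lexx.
rewrite sub0r lerN2 mdist_sclass ge_min; apply/orP; right.
rewrite leNgt; apply/negP => vw; apply: noapprox; exists m, v; split => //.
by rewrite (le_lt_trans _ vw)// ler_peMl ?sdist_ge0// ler1n.
Qed.

(** Cones with apex near [w] are controlled by [G_g] and the continuity of [h]; those with apex at
    distance at least [delta] have dropped by [M + M] once the slope is large. *)
Let envelope_limsup (h : semimetric_quotient e -> R) (M : R) : 0 <= M ->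
  continuous h -> (forall a, `|h a| <= M) ->
  forall w, W w -> forall eps, 0 < eps -> \forall k \near \oo,
    lip_env (sclass d) A (fun m v => h (sclass e (G m v))) M k (sclass d w) <=
    h (sclass e (g w)) + eps.
Proof.
move=> M0 ch hM w Ww eps eps0.
have /near_semimetricP[eta eta0 heta] :
    \forall y \near (g w : semimetric_space e),
      `|h (sclass e (g w)) - h (sclass e y)| <= eps.
  have /cvgrPdist_le := @continuous_comp _ _ _ _ _ _
    (@sclass_continuous _ _ e (g w)) (ch (sclass e (g w))).
  exact.
have [delta delta0 [N hN]] := G_g Ww eta0.
near=> k.
have Mw : - M <= h (sclass e (g w)).
  by have := hM (sclass e (g w)); rewrite ler_norml => /andP[].
apply: lip_env_le => [|m v km Amv]; first by rewrite (le_trans Mw)// lerDl ltW.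
rewrite mdist_sclass; have [vw|vw] := ltP (d v w) delta.
  have Nm : (N <= m)%N by apply: leq_trans km; near: k; exact: nbhs_infty_ge.
  have := heta (G m v); rewrite sdist_sym => /(_ (hN _ _ Nm Amv vw)).
  rewrite ler_distlC => /andP[_ hGm].
  by rewrite (le_trans _ hGm)// gerBl mulr_ge0// sdist_ge0.
have hMm : h (sclass e (G m v)) <= M := le_trans (ler_norm _) (hM _).
have kM : (M + M) / delta <= k.+1%:R.
  near: k; exists (Num.truncn ((M + M) / delta)) => // k /= Mk.
  by rewrite ltW// (lt_le_trans (truncnS_gt _))// ler_nat ltnS.
have : M + M <= k.+1%:R * d v w.
  by rewrite (le_trans _ (ler_wpM2l _ vw))// -ler_pdivrMr.
by move=> ?; lra.
Unshelve. all: by end_near. Qed.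

(** * Almost sure approximation of [X] by the sets [A m] *)

Variables (dO : nat -> measure_display) (Om : forall n, measurableType (dO n)).
Variables (P : forall n, probability (Om n) R) (Z : forall n, Om n -> D).
Hypothesis AZ : forall n (o : Om n), A n (Z o).
Variables (dT : measure_display) (T : measurableType dT) (Q : probability T R).
Variable X : T -> D.
Hypothesis XW : forall t, W (X t).
Hypothesis mX : borel_measurable (X : T -> semimetric_space d).
Hypothesis Z_X : weak_cvg P (fun n (o : Om n) => sclass d (Z o))
                          Q (fun t => sclass d (X t)).

Let measurable_sclass (h : semimetric_quotient d -> R) : continuous h ->
  measurable_fun setT (fun t => h (sclass d (X t))).
Proof. by move=> ch; exact: borel_measurable_continuous Z_X.1 ch. Qed.

Let bounded_slack k a : `|slack k a| <= 1.
Proof. by apply: lip_env_norm_le => // m v; rewrite normr0. Qed.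

Let continuous_slack k : continuous (slack k).
Proof. by apply: lip_env_continuous => // m v; rewrite normr0. Qed.

(** For [n >= k] the slack is nonnegative at [Z n], so its expectation at [X] is nonnegative in the
    limit; a nonpositive function with this property vanishes almost surely. *)
Let ae_slack0 k : {ae Q, forall t, slack k (sclass d (X t)) = 0}.
Proof.
pose f t := slack k (sclass d (X t)).
have mf : measurable_fun setT f by exact: measurable_sclass.
have [_ /(_ (slack k) (@continuous_slack k))] := Z_X.
have bs : bounded_fun (slack k).
  by apply/bounded_funP; exists 1 => // a; exact: bounded_slack.
move=> /(_ bs) slack_cvg.
have Ef0 : (0 <= 'E_Q[f])%E.
  apply: (cvge_to_ge slack_cvg); near=> n.
  apply: outer_expectation_ge0 => o /=.
  have kn : (k <= n)%N by near: n; exact: nbhs_infty_ge.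
  by apply: (le_lip_env _ _ _ kn (AZ o)) => // m v; rewrite normr0.
have : (\int[Q]_t `|(f t)%:E| = 0)%E.
  apply/eqP; rewrite eq_le integral_ge0// andbT.
  under eq_integral => t _ do rewrite /= ler0_norm ?slack_le0// EFinN.
  rewrite integralN; last first.
    apply: integrable_add_def => //.
    exact: (bounded_integrable Q mf (fun t => bounded_slack k _)).
  by move: Ef0; rewrite leeNl oppe0 unlock.
have mEf : measurable_fun setT (EFin \o f) by exact/measurable_EFinP.
move=> /(ae_eq_integral_abs Q measurableT mEf).1 fae.
by apply: filterS fae => t /(_ I) [].
Unshelve. all: by end_near. Qed.

Let slack0 : set T := [set t | forall k, slack k (sclass d (X t)) = 0].

Let measurable_slack0 : measurable slack0.
Proof.
have -> : slack0 = \bigcap_k ((fun t => slack k (sclass d (X t))) @^-1` [set 0]).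
  by apply/seteqP; split=> t /= Ht k; [move=> _|]; exact: Ht.
apply: bigcapT_measurable => k; rewrite -[_ @^-1` _]setTI.
exact: measurable_sclass.
Qed.

Let ae_slack0T : {ae Q, forall t, slack0 t}.
Proof. exact/ae_foralln/ae_slack0. Qed.

(** Half of [eps] pays for replacing [h] by one fixed envelope [env k], the other half for the weak
    convergence tested on that envelope. *)
Let expectation_limsup (X' : T -> D) (h : semimetric_quotient e -> R) (M : R) :
  {ae Q, forall t, X' t = X t} -> (forall t, W (X' t)) ->
  borel_measurable (X' : T -> semimetric_space d) ->
  borel_measurable (fun t => sclass e (g (X' t))) ->
  0 <= M -> continuous h -> (forall a, `|h a| <= M) ->
  forall eps, 0 < eps -> \forall n \near \oo,
    (outer_expectation (P n) (fun o => h (sclass e (G n (Z o)))) <=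
     'E_Q[fun t => h (sclass e (g (X' t)))] + eps%:E)%E.
Proof.
move=> X'X X'W mX' mgX' M0 ch hM eps eps0.
pose H m v := h (sclass e (G m v)).
have HM m v : `|H m v| <= M by exact: hM.
pose env k a := lip_env (sclass d) A H M k a.
have cenv k : continuous (env k) by exact: lip_env_continuous.
have envM k a : `|env k a| <= M by exact: lip_env_norm_le.
have msX' : borel_measurable (fun t => sclass d (X' t)).
  exact: borel_measurable_sclass.
have menv k : measurable_fun setT (fun t => env k (sclass d (X' t))).
  exact: borel_measurable_continuous msX' (cenv k).
have mh : measurable_fun setT (fun t => h (sclass e (g (X' t)))).
  exact: borel_measurable_continuous mgX' ch.
have eps20 : 0 < eps / 2 by rewrite divr_gt0.
have [k _ /(_ k (leqnn k)) /= hk] := expectation_limsup_le Q menv mh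
  (fun k t => envM k _) (fun t => hM _)
  (fun t => envelope_limsup M0 ch hM (X'W t)) eps20.
(* The weak convergence is known with limit [X], whereas the envelope bound holds along [X']. *)
have EX'X : ('E_Q[fun t => env k (sclass d (X' t))] =
             'E_Q[fun t => env k (sclass d (X t))])%E.
  rewrite unlock; apply: ae_eq_integral => //.
  - exact/measurable_EFinP.
  - exact/measurable_EFinP/measurable_sclass.
  - by apply: filterS X'X => t -> _.
have benv : bounded_fun (env k).
  by apply/bounded_funP; exists (M + 1) => [|a];
    [rewrite ltr_wpDl|rewrite (le_trans (envM k a))// lerDl].
have Efin : ('E_Q[fun t => env k (sclass d (X t))])%E \is a fin_num.
  rewrite unlock; apply: integrable_fin_num => //.
  exact: (bounded_integrable Q (measurable_sclass (cenv k)) (fun t => envM k _)).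
have env_cvg := Z_X.2 (env k) (cenv k) benv.
rewrite -[X in _ --> X]fineK// in env_cvg.
have [ufin /cvgrPdist_le/(_ _ eps20) uE] := (fine_cvgP _ _).1 env_cvg.
near=> n.
have kn : (k <= n)%N by near: n; exact: nbhs_infty_ge.
apply: (@le_trans _ _ (outer_expectation (P n)
    (fun o => env k (sclass d (Z o))))).
  apply: le_outer_expectation => o.
  exact: (le_lip_env (sclass d) M0 HM kn (AZ o)).
have un : outer_expectation (P n) (fun o => env k (sclass d (Z o))) \is a fin_num.
  by near: n; exact: ufin.
have := hk; rewrite EX'X => /(leeD2r (eps / 2)%:E).
rewrite -addeA -EFinD -splitr; apply: le_trans.
rewrite -(fineK un) -[in leRHS](fineK Efin) -EFinD lee_fin.
have : `|fine ('E_Q[fun t => env k (sclass d (X t))])%E -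
  fine (outer_expectation (P n) (fun o => env k (sclass d (Z o))))| <= eps / 2.
  by near: n; exact: uE.
by rewrite ler_distlC => /andP[_].
Unshelve. all: by end_near. Qed.

Lemma extended_continuous_mapping : exists X' : T -> D,
  [/\ is_version d W Q X X',
      borel_measurable ((g \o X') : T -> semimetric_space e)
    & weak_cvg P (fun n (o : Om n) => sclass e (G n (Z o)))
               Q (fun t => sclass e (g (X' t)))].
Proof.
(* An event of full probability is nonempty; [X t0] becomes the default value of the version off
   [slack0]. *)
have [t0 slack_t0] : exists t0, slack0 t0.
  apply: contrapT => noslack0; have [N [_ + subN]] := ae_slack0T.
  have -> : N = setT.
    by apply/seteqP; split=> // t _; apply: subN => st; apply: noslack0; exists t.
  by rewrite probability_setT => -[/eqP]; rewrite oner_eq0.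
pose X' t := if t \in slack0 then X t else X t0.
have X'X : {ae Q, forall t, X' t = X t}.
  by apply: filterS ae_slack0T => t st; rewrite /X' mem_set.
have X'W t : W (X' t) by rewrite /X'; case: ifP.
have LX' t : limit_pts (X' t).
  by rewrite /X'; case: ifPn => [/set_mem st|_]; exact: slack0_limit_pts.
have mX' : borel_measurable (X' : T -> semimetric_space d).
  apply: measurable_fun_ifT => //; apply: (measurable_fun_bool true).
  rewrite setTI [X in measurable X](_ : _ = slack0)//.
  by apply/seteqP; split=> t /=; [move/set_mem|move/mem_set].
have mgX' := borel_comp_limit_pts mX' LX'.
have msgX' : borel_measurable (fun t => sclass e (g (X' t))).
  exact: borel_measurable_sclass mgX'.
exists X'; split => //; split => // h ch /bounded_funP[M M0 hM].
have mhgX' := borel_measurable_continuous msgX' ch.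
have Efin : ('E_Q[fun t => h (sclass e (g (X' t)))])%E \is a fin_num.
  rewrite unlock; apply: integrable_fin_num => //.
  exact: (bounded_integrable Q mhgX' (fun t => hM _)).
rewrite -[X in _ --> X]fineK//; apply: cvge_fin_dist_le => eps eps0.
have := expectation_limsup X'X X'W mX' msgX' (ltW M0) ch hM eps0.
(* The lower half follows from the upper bound applied to [- h]. *)
have chN : continuous (fun a => - h a) by move=> a; apply: (@cvgN _ R^o _ _ _ h) (ch a).
have hNM a : `|- h a| <= M by rewrite normrN.
have := expectation_limsup X'X X'W mX' msgX' (ltW M0) chN hNM eps0.
apply: filterS2 => n lo up.
rewrite EFinB EFinD fineK// up andbT.
apply: le_trans (oppe_outer_expectation _ _).
rewrite leeNr; apply: (le_trans lo).
have -> : ('E_Q[fun t => (- h (sclass e (g (X' t))))%R] =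
           - 'E_Q[fun t => h (sclass e (g (X' t)))])%E.
  rewrite unlock -integralN; first by apply: eq_integral => t _; rewrite EFinN.
  apply: integrable_add_def => //.
  exact: (bounded_integrable Q mhgX' (fun t => hM _)).
by rewrite fin_num_oppeB.
Qed.

End extended_continuous_mapping.

(** * From semi-Hadamard differentiability to the delta method *)

Lemma semi_hadamard_extended_continuous (R : realType) (D E : lmodType R)
    (d : semimetric R D) (e : semimetric R E) (DPsi : set D) (Psi : D -> E)
    (x : D) (W : set D) (dPsi : D -> E) (r : nat -> R) :
  is_semi_hadamard d e DPsi Psi x W dPsi ->
  (forall n, 0 < r n) -> r @ \oo --> +oo ->
  forall w, W w -> forall eps, 0 < eps ->
  exists2 delta, 0 < delta & exists N, forall m v, (N <= m)%N ->
    DPsi (x + (r m)^-1 *: v) -> d v w < delta ->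
    e (r m *: (Psi (x + (r m)^-1 *: v) - Psi x)) (dPsi w) < eps.
Proof.
move=> hPsi r0 roo w Ww eps eps0; apply: contrapT => noN.
(* Failure at [delta = 1 / k.+1] and [N = k] yields an index and a direction for each [k]. The
   indices need not increase, but they tend to infinity, so [t] tends to 0 and the differentiability
   is contradicted. *)
have /choice[mv mvP] : forall k : nat, exists mv : nat * D,
    [/\ (k <= mv.1)%N, DPsi (x + (r mv.1)^-1 *: mv.2),
      d mv.2 w < k.+1%:R^-1
    & eps <= e (r mv.1 *: (Psi (x + (r mv.1)^-1 *: mv.2) - Psi x)) (dPsi w)].
  move=> k; apply: contrapT => nomv; apply: noN.
  exists k.+1%:R^-1 => //; exists k => m v km Dv vw.
  by rewrite ltNge; apply/negP => ev; apply: nomv; exists (m, v).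
pose t k := (r (mv k).1)^-1.
have t0 k : 0 < t k by rewrite invr_gt0.
have mvoo : (fun k => (mv k).1) @ \oo --> \oo.
  move=> B [N _ NB]; exists N => // k /= Nk; apply: NB => /=.
  by apply: leq_trans Nk _; have [] := mvP k.
have tcvg : t @ \oo --> (0 : R).
  apply/(@gtr0_cvgV0 _ _ _ _ (fun k => r (mv k).1)); first exact: nearW.
  exact: cvg_comp mvoo roo.
have vcvg : (fun k => d (mv k).2 w) @ \oo --> (0 : R).
  apply: (@squeeze_cvgr _ _ _ _ (cst 0) harmonic).
  - by apply: nearW => k; rewrite sdist_ge0 ltW//; have [] := mvP k.
  - exact: cvg_cst.
  - exact: cvg_harmonic.
have Dt k : DPsi (x + t k *: (mv k).2) by have [] := mvP k.
have /cvgrPdist_lt/(_ _ eps0)[N _ /(_ N (leqnn N))] :=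
  hPsi w Ww t (fun k => (mv k).2) t0 tcvg Dt vcvg.
rewrite /= sub0r normrN invrK ger0_norm ?sdist_ge0// ltNge.
by have [_ _ _ ->] := mvP N.
Qed.

Theorem theorem8p7 (R : realType) (D E : lmodType R)
    (d : semimetric R D) (e : semimetric R E)
    (DPsi : set D) (Psi : D -> E) (x : D) (W : set D) (dPsi : D -> E)
    (hx : DPsi x) (hPsi : is_semi_hadamard d e DPsi Psi x W dPsi)
    (dO : nat -> measure_display) (Om : forall n, measurableType (dO n))
    (P : forall n, probability (Om n) R) (Y : forall n, Om n -> D)
    (hY : forall n o, DPsi (Y n o))
    (dT : measure_display) (T : measurableType dT) (Q : probability T R)
    (X : T -> D) (hXW : forall t, W (X t))
    (hX : borel_measurable (X : T -> semimetric_space d))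
    (r : nat -> R) (hr0 : forall n, 0 < r n) (hr : r @ \oo --> +oo)
    (hcvg : weak_cvg P (fun n o => sclass d (r n *: (Y n o - x)))
                     Q (fun t => sclass d (X t))) :
  let delta_conclusion (X' : T -> D) :=
    borel_measurable ((dPsi \o X') : T -> semimetric_space e) /\
    weak_cvg P (fun n o => sclass e (r n *: (Psi (Y n o) - Psi x)))
             Q (fun t => sclass e (dPsi (X' t))) in
  delta_conclusion X \/
  exists X' : T -> D, is_version d W Q X X' /\ delta_conclusion X'.
Proof.
(* The version is taken in every case, since [dPsi] is controlled only at limit points of the sets
   [A m]. *)
move=> /=; right.
have Hcm := semi_hadamard_extended_continuous hPsi hr0 hr.
pose A m := [set v | DPsi (x + (r m)^-1 *: v)].
pose Z n (o : Om n) := r n *: (Y n o - x).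
have YZ n (o : Om n) : x + (r n)^-1 *: Z n o = Y n o.
  by rewrite scalerA mulVf ?gt_eqF// scale1r addrC subrK.
have AZ n (o : Om n) : A n (Z n o) by rewrite /A /= YZ.
have [X' [X'X mX' cvgX']] :=
  @extended_continuous_mapping _ _ _ _ _ A _ _ _ Hcm _ _ _ _ AZ _ _ _ _ hXW hX hcvg.
exists X'; split=> //; split=> //; move: cvgX'.
rewrite (_ : (fun n (o : Om n) => _) =
  (fun n (o : Om n) => sclass e (r n *: (Psi (Y n o) - Psi x))))//.
by apply: functional_extensionality_dep => n; apply/funext => o; rewrite YZ.
Qed.
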